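(* Let $\underline{\eta}(\theta) > 0$ hold, and let $\tilde{x}_\theta(\mathbf{u}) \in \mathcal{X}$ be an approximation to $x_\theta(\mathbf{u})$ such that $$\|x_\theta(\mathbf{u}) - \tilde{x}_\theta(\mathbf{u})\|_{\mathcal{X}} \le \varepsilon_\theta \|x_\theta(\mathbf{u})\|_{\mathcal{X}}, \qquad 0\le \varepsilon_\theta\le\varepsilon<1,$$ holds for all $\theta\in\mathcal{P}$ and $\mathbf{u}\in\mathbb{R}^M$. Then $$(1-\varepsilon_\theta)\,\tilde\beta_{L|\mathcal{W}}(\theta) - \gamma_L\,\varepsilon_\theta \;\le\; \beta_{L|\mathcal{W}}(\theta) \;\le\; (1+\varepsilon_\theta)\,\tilde\beta_{L|\mathcal{W}}(\theta) + \gamma_L\,\varepsilon_\theta.$$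
   Context: Setting. $\mathcal{X}$ is a real Hilbert space with inner product $\langle\cdot,\cdot\rangle_{\mathcal{X}}$, norm $\|\cdot\|_{\mathcal{X}}$ and dual $\mathcal{X}'$; $\mathcal{P} \subset \mathbb{R}^p$ is a compact set of hyper-parameters (configurations). For each $\theta\in\mathcal{P}$ and each parameter $\mathbf{u}\in\mathbb{R}^M$ there is a (full-order) state $x_\theta(\mathbf{u})\in\mathcal{X}$; the map $\mathbf{u}\mapsto x_\theta(\mathbf{u})$ is linear. $\Sigma_{\mathrm{pr}}\in\mathbb{R}^{M\times M}$ is a symmetric positive definite (prior covariance) matrix, and $\|\mathbf{u}\|_{\Sigma_{\mathrm{pr}}^{-1}}^2 := \mathbf{u}^T\Sigma_{\mathrm{pr}}^{-1}\mathbf{u}$. The states are uniformly bounded: there is $\bar\eta>0$ with $\overline{\eta}(\theta) := \sup_{\mathbf{u}\neq 0} \|x_\theta(\mathbf{u})\|_{\mathcal{X}} / \|\mathbf{u}\|_{\Sigma_{\mathrm{pr}}^{-1}} < \bar\eta$ for all $\theta\in\mathcal{P}$. The surrogate $\mathbf{u}\mapsto\tilde x_\theta(\mathbf{u})\in\mathcal{X}$ is not assumed to have further structure. Observation operator. $L = [\ell_1,\dots,\ell_K]^T : \mathcal{X}\to\mathbb{R}^K$, $Lx = [\ell_1(x),\dots,\ell_K(x)]^T$, with continuous linear functionals $\ell_k\in\mathcal{X}'$. $\Sigma_L\in\mathbb{R}^{K\times K}$ is symmetric positive definite (noise covariance), and $\|\mathbf{d}\|_{\Sigma_L^{-1}}^2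 := \mathbf{d}^T\Sigma_L^{-1}\mathbf{d}$. Coefficients (all infima and suprema of quotients are over nonzero elements): $$\gamma_L := \sup_{x\in\mathcal{X}} \frac{\|Lx\|_{\Sigma_L^{-1}}}{\|x\|_{\mathcal{X}}},\quad \underline{\eta}(\theta) := \inf_{\mathbf{u}\in\mathbb{R}^M}\frac{\|x_\theta(\mathbf{u})\|_{\mathcal{X}}}{\|\mathbf{u}\|_{\Sigma_{\mathrm{pr}}^{-1}}},\quad \mathcal{W}_\theta := \{x_\theta(\mathbf{u}) : \mathbf{u}\in\mathbb{R}^M\},$$ $$\beta_{L|\mathcal{W}}(\theta) := \inf_{x\in\mathcal{W}_\theta}\frac{\|Lx\|_{\Sigma_L^{-1}}}{\|x\|_{\mathcal{X}}},\qquad \tilde\beta_{L|\mathcal{W}}(\theta) := \inf_{\mathbf{u}\in\mathbb{R}^M\setminus\{0\}}\frac{\|L\tilde x_\theta(\mathbf{u})\|_{\Sigma_L^{-1}}}{\|\tilde x_\theta(\mathbf{u})\|_{\mathcal{X}}}.$$ *)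

(* Defs.v *)
From HB Require Import structures.
From mathcomp Require Import all_boot all_order all_algebra.
From mathcomp Require Import all_classical all_reals all_analysis.

Set Implicit Arguments.
Unset Strict Implicit.
Unset Printing Implicit Defensive.

Import Order.TTheory GRing.Theory Num.Theory.
Import numFieldNormedType.Exports.

Local Open Scope classical_set_scope.
Local Open Scope ring_scope.

Definition sym_posdef (R : realType) (n : nat) (S : 'M[R]_n) : Prop :=
  S \is symmetricmx /\ forall v : 'cV[R]_n, v != 0 -> 0 < (v^T *m S *m v) 0 0.

(* The norm weighted by the inverse of S: cov_norm S v ^+ 2 = v^T S^-1 v. *)
Definition cov_norm (R : realType) (n : nat) (S : 'M[R]_n) (v : 'cV[R]_n) : R :=
  Num.sqrt ((v^T *m invmx S *m v) 0 0).

Definition obs_op (R : realType) (X : normedModType R) (K : nat)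
    (l : 'I_K -> {linear X -> R^o}) (x : X) : 'cV[R]_K :=
  \col_k l k x.

(* The coefficients are extended-real infima and suprema, so that empty or
   unbounded families receive no arbitrary real value. *)

Definition gamma_obs (R : realType) (X : normedModType R) (K : nat)
    (l : 'I_K -> {linear X -> R^o}) (SigmaL : 'M[R]_K) : \bar R :=
  ereal_sup [set (cov_norm SigmaL (obs_op l x) / `|x|)%:E
            | x in [set x : X | x != 0]].

Definition eta_sup (R : realType) (X : normedModType R) (M : nat)
    (Sigmapr : 'M[R]_M) (x : 'cV[R]_M -> X) : \bar R :=
  ereal_sup [set (`|x u| / cov_norm Sigmapr u)%:E
            | u in [set u : 'cV[R]_M | u != 0]].

Definition eta_inf (R : realType) (X : normedModType R) (M : nat)
    (Sigmapr : 'M[R]_M) (x : 'cV[R]_M -> X) : \bar R :=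
  ereal_inf [set (`|x u| / cov_norm Sigmapr u)%:E
            | u in [set u : 'cV[R]_M | u != 0]].

Definition state_space (R : realType) (X : normedModType R) (M : nat)
    (x : 'cV[R]_M -> X) : set X :=
  range x.

Definition beta_obs (R : realType) (X : normedModType R) (K : nat)
    (l : 'I_K -> {linear X -> R^o}) (SigmaL : 'M[R]_K) (W : set X) : \bar R :=
  ereal_inf [set (cov_norm SigmaL (obs_op l w) / `|w|)%:E
            | w in W `&` [set w : X | w != 0]].

(* Indexed by the parameters u, not by the elements of the range of xt: xt need
   not be linear. Division by zero yields 0 should xt u vanish, but a relative
   error below 1 with respect to a nonzero state excludes that case. *)
Definition beta_sur (R : realType) (X : normedModType R) (M K : nat)
    (l : 'I_K -> {linear X -> R^o}) (SigmaL : 'M[R]_K)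
    (xt : 'cV[R]_M -> X) : \bar R :=
  ereal_inf [set (cov_norm SigmaL (obs_op l (xt u)) / `|xt u|)%:E
            | u in [set u : 'cV[R]_M | u != 0]].

(* Main.v *)
Require Import Defs.
From HB Require Import structures.
From mathcomp Require Import all_boot all_order all_algebra.
From mathcomp Require Import all_classical all_reals all_analysis.
From mathcomp Require Import ring lra.

Set Implicit Arguments.
Unset Strict Implicit.
Unset Printing Implicit Defensive.

Import Order.TTheory GRing.Theory Num.Theory.
Import numFieldNormedType.Exports.

Local Open Scope classical_set_scope.
Local Open Scope ring_scope.

(** The surrogate [y] of a state [x] satisfies [|x - y| <= e * |x|] with [e < 1],
    hence [(1 - e) * |x| <= |y| <= (1 + e) * |x|]: the quotients
    [|L y| / |x|] and [|L y| / |y|] differ by a factor between [1 - e] and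
    [1 + e].  Changing the numerator from [|L x|] to [|L y|] costs at most
    [|L (x - y)|], by the triangle inequality for the noise-weighted norm, and
    [|L (x - y)| / |x| <= gamma * e] by definition of [gamma].  So the quotients
    of [x] and [y] satisfy the two claimed bounds parameter by parameter
    ([sur_quotient_le] and [obs_quotient_le]), and the bounds pass to the infima.
    The infima range over matching families because [u != 0] is equivalent to
    [x u != 0]: one direction is linearity, the other is positivity of the lower
    bound [eta_inf].

    The weighted norm is a norm because the inverse of a symmetric positive
    definite matrix is again symmetric positive definite, which gives a
    Cauchy-Schwarz inequality.

    Since [gamma] is an extended real, the error term [gamma * e] may be infinite;
    then the lower bound reads [-oo <= _] and the upper bound [_ <= +oo], and
    otherwise it can be moved across the inequalities like a real number.  For
    [e = 0] it vanishes, consistently with [x = y]. *)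

(** * The norm weighted by an inverse covariance *)

Lemma trmx_symmetricmx (R : fieldType) (n : nat) (S : 'M[R]_n) :
  S \is symmetricmx -> S^T = S.
Proof. by move=> /is_hermitianmxP; rewrite expr0 scale1r map_mx_id// => <-. Qed.

Lemma symmetricmx_formC (R : fieldType) (n : nat) (S : 'M[R]_n)
    (u v : 'cV[R]_n) : S \is symmetricmx ->
  (v^T *m S *m u) 0 0 = (u^T *m S *m v) 0 0.
Proof.
move=> /trmx_symmetricmx trS.
by rewrite -[in LHS](trmxK u) -[in LHS]trS -mulmxA -!trmx_mul mxE.
Qed.

Lemma sym_posdef_ge0 (R : realType) (n : nat) (S : 'M[R]_n) (v : 'cV[R]_n) :
  sym_posdef S -> 0 <= (v^T *m S *m v) 0 0.
Proof.
move=> [_ Spos]; have [->|v0] := eqVneq v 0; last exact/ltW/Spos.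
by rewrite mulmx0 mxE.
Qed.

Lemma sym_posdef_unitmx (R : realType) (n : nat) (S : 'M[R]_n) :
  sym_posdef S -> S \in unitmx.
Proof.
move=> [_ Spos]; rewrite -row_free_unit; apply: inj_row_free => v vS0.
apply/eqP; apply: contraT => v0.
have := Spos v^T; rewrite trmx_eq0 => /(_ v0).
by rewrite trmxK vS0 mul0mx mxE ltxx.
Qed.

(** Substituting [S *m w] for the vector turns the form of [invmx S] into the
    form of [S]. *)
Lemma sym_posdef_invmx (R : realType) (n : nat) (S : 'M[R]_n) :
  sym_posdef S -> sym_posdef (invmx S).
Proof.
move=> Sspd; have Su := sym_posdef_unitmx Sspd; have [Ssym Spos] := Sspd.
have symV : (invmx S)^T = invmx S by rewrite trmx_inv (trmx_symmetricmx Ssym).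
split.
  by apply/is_hermitianmxP; rewrite expr0 scale1r map_mx_id// symV.
move=> v v0; have w0 : invmx S *m v != 0.
  by apply: contra v0 => /eqP w0; rewrite -(mulKVmx Su v) w0 mulmx0.
have := Spos _ w0.
by rewrite trmx_mul symV -!mulmxA (mulKVmx Su) !mulmxA.
Qed.

(** The form is nonnegative at the multiple of the residual of [u] after
    projection onto [v]; expanding it there gives the inequality. *)
Lemma sym_posdef_CauchySchwarz (R : realType) (n : nat) (S : 'M[R]_n)
    (u v : 'cV[R]_n) : sym_posdef S ->
  (u^T *m S *m v) 0 0 ^+ 2 <= (u^T *m S *m u) 0 0 * (v^T *m S *m v) 0 0.
Proof.
move=> Sspd; have [Ssym Spos] := Sspd.
have [->|v0] := eqVneq v 0; first by rewrite !mulmx0 !mxE mulr0 expr0n.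
have vu := symmetricmx_formC u v Ssym.
have := Spos v v0.
set a := (u^T *m S *m u) 0 0; set b := (u^T *m S *m v) 0 0.
set c := (v^T *m S *m v) 0 0 => c0.
have := sym_posdef_ge0 (c *: u - b *: v) Sspd.
rewrite [(_ - _)^T]linearB/= ![(_ *: _)^T]linearZ/= !mulmxBl !mulmxBr -!scalemxAl -!scalemxAr.
have eB (A B : 'M[R]_1) : (A - B) 0 0 = A 0 0 - B 0 0 by rewrite !mxE.
have eZ k (A : 'M[R]_1) : (k *: A) 0 0 = k * A 0 0 by rewrite mxE.
rewrite !(eB, eZ) vu -/a -/b -/c.
have -> : c * (c * a) - c * (b * b) - (b * (c * b) - b * (b * c)) =
  c * (a * c - b ^+ 2) by ring.
by rewrite pmulr_rge0// subr_ge0.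
Qed.

Lemma cov_norm_ge0 (R : realType) (n : nat) (S : 'M[R]_n) (v : 'cV[R]_n) :
  0 <= cov_norm S v.
Proof. exact: sqrtr_ge0. Qed.

Lemma cov_norm0 (R : realType) (n : nat) (S : 'M[R]_n) : cov_norm S 0 = 0.
Proof. by rewrite /cov_norm mulmx0 mxE sqrtr0. Qed.

Lemma cov_normD (R : realType) (n : nat) (S : 'M[R]_n) (u v : 'cV[R]_n) :
  sym_posdef S -> cov_norm S (u + v) <= cov_norm S u + cov_norm S v.
Proof.
move=> /sym_posdef_invmx Vspd; have [Vsym _] := Vspd.
have vu := symmetricmx_formC u v Vsym.
rewrite -ler_sqr ?nnegrE ?addr_ge0 ?cov_norm_ge0//.
rewrite sqrrD !sqr_sqrtr ?sym_posdef_ge0// -sqrtrM ?sym_posdef_ge0//.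
rewrite [(u + v)^T]linearD/= !mulmxDl !mulmxDr.
have eD (A B : 'M[R]_1) : (A + B) 0 0 = A 0 0 + B 0 0 by rewrite mxE.
rewrite !eD vu.
have := sym_posdef_CauchySchwarz u v Vspd.
rewrite -ler_sqrt ?mulr_ge0 ?sym_posdef_ge0// sqrtr_sqr => /(le_trans (ler_norm _)).
lra.
Qed.

(** * Observations of a state and of its surrogate *)

Lemma obs_opD (R : realType) (X : normedModType R) (K : nat)
    (l : 'I_K -> {linear X -> R^o}) (x y : X) :
  obs_op l (x + y) = obs_op l x + obs_op l y.
Proof. by apply/colP => k; rewrite !mxE linearD. Qed.

Lemma obs_op0 (R : realType) (X : normedModType R) (K : nat)
    (l : 'I_K -> {linear X -> R^o}) : obs_op l 0 = 0.
Proof. by apply/colP => k; rewrite !mxE linear0. Qed.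

Lemma gamma_obs_ge0 (R : realType) (X : normedModType R) (K : nat)
    (l : 'I_K -> {linear X -> R^o}) (S : 'M[R]_K) (x : X) :
  x != 0 -> (0 <= gamma_obs l S)%E.
Proof.
move=> x0; apply: le_ereal_sup_tmp.
exists (cov_norm S (obs_op l x) / `|x|)%:E; first by exists x.
by rewrite lee_fin divr_ge0 ?cov_norm_ge0.
Qed.

(** The case [z = 0] is separate because [gamma] only controls the quotients of
    nonzero elements; it also covers [e = 0]. *)
Lemma obs_perturbation_le (R : realType) (X : normedModType R) (K : nat)
    (l : 'I_K -> {linear X -> R^o}) (S : 'M[R]_K) (x z : X) (e : R) :
  x != 0 -> 0 <= e -> `|z| <= e * `|x| ->
  ((cov_norm S (obs_op l z) / `|x|)%:E <= gamma_obs l S * e%:E)%E.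
Proof.
move=> x0 e0 zx; have xp : 0 < `|x| by rewrite normr_gt0.
have [->|z0] := eqVneq z 0.
  by rewrite obs_op0 cov_norm0 mul0r mule_ge0 ?(gamma_obs_ge0 l S x0) ?lee_fin.
apply: (@le_trans _ _ ((cov_norm S (obs_op l z) / `|z|)%:E * e%:E)%E).
  rewrite -EFinM lee_fin -mulrA ler_wpM2l ?cov_norm_ge0//.
  by rewrite mulrC ler_pdivlMr ?normr_gt0// mulrC ler_pdivrMr.
apply: lee_wpmul2r; first by rewrite lee_fin.
by apply: ereal_sup_ubound; exists z.
Qed.

(** This keeps the quotients of the surrogate away from the value [0] that
    division by zero would give them. *)
Lemma relative_error_neq0 (R : realType) (X : normedModType R) (x y : X)
    (e : R) : x != 0 -> e < 1 -> `|x - y| <= e * `|x| -> y != 0.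
Proof.
move=> x0 e1 xy; apply: contraL xy => /eqP ->.
by rewrite subr0 -ltNge gtr_pMl ?normr_gt0.
Qed.

(** Two exchanges, through the mixed quotient [|L y| / |x|]: the denominator by
    [(1 - e) * |x| <= |y|], then the numerator by [L y = L (y - x) + L x]. *)
Lemma sur_quotient_le (R : realType) (X : normedModType R) (K : nat)
    (l : 'I_K -> {linear X -> R^o}) (S : 'M[R]_K) (x y : X) (e : R) :
  sym_posdef S -> x != 0 -> 0 <= e < 1 -> `|x - y| <= e * `|x| ->
  (((1 - e) * (cov_norm S (obs_op l y) / `|y|))%:E
     <= (cov_norm S (obs_op l x) / `|x|)%:E + gamma_obs l S * e%:E)%E.
Proof.
move=> Sspd x0 /andP[e0 e1] xy; have y0 := relative_error_neq0 x0 e1 xy.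
have [xp yp] : 0 < `|x| /\ 0 < `|y| by rewrite !normr_gt0.
have yx : `|y - x| <= e * `|x| by rewrite distrC.
apply: le_trans (leeD2l _ (obs_perturbation_le l S x0 e0 yx)).
rewrite -EFinD lee_fin -mulrDl.
apply: (@le_trans _ _ (cov_norm S (obs_op l y) / `|x|)).
  rewrite mulrCA ler_wpM2l ?cov_norm_ge0//.
  rewrite ler_pdivrMr// mulrC ler_pdivlMr//.
  by have := ler_distD y x 0; rewrite !subr0; lra.
rewrite ler_pM2r ?invr_gt0//; apply: le_trans (cov_normD _ _ Sspd).
by rewrite -obs_opD addrC subrK.
Qed.

(** The same two exchanges in the opposite direction, with
    [|y| <= (1 + e) * |x|] for the denominator. *)
Lemma obs_quotient_le (R : realType) (X : normedModType R) (K : nat)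
    (l : 'I_K -> {linear X -> R^o}) (S : 'M[R]_K) (x y : X) (e : R) :
  sym_posdef S -> x != 0 -> 0 <= e < 1 -> `|x - y| <= e * `|x| ->
  ((cov_norm S (obs_op l x) / `|x|)%:E
     <= ((1 + e) * (cov_norm S (obs_op l y) / `|y|))%:E
        + gamma_obs l S * e%:E)%E.
Proof.
move=> Sspd x0 /andP[e0 e1] xy; have y0 := relative_error_neq0 x0 e1 xy.
have [xp yp] : 0 < `|x| /\ 0 < `|y| by rewrite !normr_gt0.
apply: le_trans (leeD2l _ (obs_perturbation_le l S x0 e0 xy)).
rewrite -EFinD lee_fin.
apply: (@le_trans _ _
    (cov_norm S (obs_op l y) / `|x| + cov_norm S (obs_op l (x - y)) / `|x|)).
  rewrite -mulrDl ler_pM2r ?invr_gt0//; apply: le_trans (cov_normD _ _ Sspd).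
  by rewrite -obs_opD addrC subrK.
rewrite lerD2r mulrCA ler_wpM2l ?cov_norm_ge0//.
rewrite ler_pdivlMr// mulrC ler_pdivrMr//.
by have := ler_distD x y 0; rewrite !subr0 distrC; lra.
Qed.

(** * Parameters and states *)

Lemma eta_inf_gt0_neq0 (R : realType) (X : normedModType R) (M : nat)
    (S : 'M[R]_M) (x : 'cV[R]_M -> X) (u : 'cV[R]_M) :
  (0 < eta_inf S x)%E -> u != 0 -> x u != 0.
Proof.
move=> eta0 u0; have : (0 < (`|x u| / cov_norm S u)%:E)%E.
  by apply: lt_le_trans eta0 _; apply: ereal_inf_lbound; exists u.
by rewrite lte_fin; apply: contraTneq => ->; rewrite normr0 mul0r ltxx.
Qed.

Lemma linear_neq0 (R : realType) (X : normedModType R) (M : nat)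
    (x : 'cV[R]_M -> X) (u : 'cV[R]_M) : linear x -> x u != 0 -> u != 0.
Proof.
move=> xlin; apply: contra => /eqP ->.
by have := xlin (-1) 0 0; rewrite !scaleN1r oppr0 addr0 addNr => ->.
Qed.

Theorem proposition1 (R : realType)
    (* real Hilbert space: complete, with norm induced by an inner product *)
    (X : completeNormedModType R) (dot : {dot X for idfun})
    (hdot : forall x : X, `|x| = Num.sqrt (dot x x))
    (p M K : nat) (hM : (0 < M)%N)
    (P : set 'cV[R]_p) (hP : compact P)
    (Sigmapr : 'M[R]_M) (hSigmapr : sym_posdef Sigmapr)
    (x : 'cV[R]_p -> 'cV[R]_M -> X)
    (hx : forall theta, P theta -> linear (x theta))
    (etabar : R) (hetabar : 0 < etabar)
    (hbound : forall theta, P theta ->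
       (eta_sup Sigmapr (x theta) < etabar%:E)%E)
    (l : 'I_K -> {linear X -> R^o}) (hl : forall k, continuous (l k))
    (SigmaL : 'M[R]_K) (hSigmaL : sym_posdef SigmaL)
    (xt : 'cV[R]_p -> 'cV[R]_M -> X)
    (eps : 'cV[R]_p -> R) (epsbar : R) (hepsbar : epsbar < 1)
    (heps : forall theta, P theta -> 0 <= eps theta <= epsbar)
    (happrox : forall theta, P theta -> forall u : 'cV[R]_M,
       `|x theta u - xt theta u| <= eps theta * `|x theta u|)
    (theta : 'cV[R]_p) (htheta : P theta)
    (heta : (0 < eta_inf Sigmapr (x theta))%E) :
  ((1 - eps theta)%:E * beta_sur l SigmaL (xt theta)
       - gamma_obs l SigmaL * (eps theta)%:E
     <= beta_obs l SigmaL (state_space (x theta)))%E /\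
  (beta_obs l SigmaL (state_space (x theta))
     <= (1 + eps theta)%:E * beta_sur l SigmaL (xt theta)
       + gamma_obs l SigmaL * (eps theta)%:E)%E.
Proof.
have /andP[e0 e_le] := heps _ htheta; have e1 := le_lt_trans e_le hepsbar.
have e01 : 0 <= eps theta < 1 by rewrite e0 e1.
(* A nonzero state is what makes [gamma] nonnegative rather than the supremum
   [-oo] of an empty family. *)
have [u1 u10] : exists u : 'cV[R]_M, u != 0.
  exists (const_mx 1); apply/eqP => /colP/(_ (Ordinal hM)).
  by rewrite !mxE => /eqP; rewrite oner_eq0.
have g0 : (0 <= gamma_obs l SigmaL * (eps theta)%:E)%E.
  apply: mule_ge0; last by rewrite lee_fin.
  exact: gamma_obs_ge0 (eta_inf_gt0_neq0 heta u10).
have sur u (xu0 : x theta u != 0) :=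
  sur_quotient_le l hSigmaL xu0 e01 (happrox _ htheta u).
have obs u (xu0 : x theta u != 0) :=
  obs_quotient_le l hSigmaL xu0 e01 (happrox _ htheta u).
set g := (gamma_obs l SigmaL * _)%E in g0 sur obs *.
split.
  apply/ereal_infP => _ [_ [[u _ <-] xu0] <-].
  have : ((1 - eps theta)%:E * beta_sur l SigmaL (xt theta) <=
      (cov_norm SigmaL (obs_op l (x theta u)) / `|x theta u|)%:E + g)%E.
    apply: le_trans (sur _ xu0); rewrite EFinM lee_wpmul2l//.
      by rewrite lee_fin subr_ge0 ltW.
    by apply: ereal_inf_lbound; exists u => //; exact: linear_neq0 (hx _ htheta) xu0.
  case: g g0 {sur obs} => [r||]// _; first by rewrite leeBlDr.
  by rewrite addeNy leNye.
have beta_le u : u != 0 -> (beta_obs l SigmaL (state_space (x theta)) <=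
    ((1 + eps theta) * (cov_norm SigmaL (obs_op l (xt theta u)) / `|xt theta u|))%:E
    + g)%E.
  move=> u0; have xu0 := eta_inf_gt0_neq0 heta u0.
  apply: le_trans (obs _ xu0); apply: ereal_inf_lbound.
  by exists (x theta u) => //; split => //; exists u.
have e1p : 0 < 1 + eps theta by rewrite ltr_pwDl.
(* The convention [-oo + +oo = -oo] would break the upper bound for an infinite
   [g] if [beta_sur] could be [-oo]. *)
have sur_ge0 : (0 <= beta_sur l SigmaL (xt theta))%E.
  apply/ereal_infP => _ [u _ <-].
  by rewrite lee_fin divr_ge0 ?cov_norm_ge0.
case: g g0 {sur obs} beta_le => [r||]// _ beta_le; last first.
  rewrite addey ?leey//.
  by rewrite gt_eqF// (lt_le_trans (ltNyr 0))// mule_ge0// lee_fin ltW.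
rewrite -leeBlDr// -lee_pdivrMl//.
apply/ereal_infP => _ [u u0 <-].
by rewrite lee_pdivrMl// -EFinM leeBlDr// beta_le.
Qed.
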